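(* The numbers $a_n$ with $n\ge 2$ are increasing positive integers; that is, for every integer $n\ge 2$, $a_n$ is a positive integer and $a_{n+1}>a_n$. Moreover, for $n\ge 2$, $a_n$ is odd if and only if $n=2^k-2$ for some integer $k\ge 2$.
   Context: For $n\ge 0$ let $C_n=\frac{1}{n+1}\binom{2n}{n}$ be the $n$-th Catalan number. The integers $A_n$, $n\ge 1$, are defined inductively by \[(-1)^{n-1}A_n=C_n+\sum_{j=1}^{n-1}(-1)^{j}\binom{2n-1}{2j-1}A_j\,C_{n-j}\qquad (n\ge 1),\] and the rational numbers $a_n$ are defined by $a_n=2A_n/C_n$ for $n\ge 1$. *)

(* Defs.v *)
From mathcomp Require Import all_boot all_order all_algebra.

Set Implicit Arguments.
Unset Strict Implicit.
Unset Printing Implicit Defensive.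

Import Order.TTheory GRing.Theory Num.Theory.
Local Open Scope ring_scope.

Definition catalan (n : nat) : nat := ('C(n.*2, n) %/ n.+1)%N.

(* The Euclidean division in [catalan] is exact. *)
Lemma mul_catalan (n : nat) : (n.+1 * catalan n = 'C(n.*2, n))%N.
Proof.
rewrite mulnC divnK //.
have := mul_bin_left n.*2 n.
rewrite -addnn addnK => E.
have cop : coprime n.+1 n by rewrite coprimeSn.
by rewrite -(Gauss_dvdr _ cop) -E dvdn_mulr.
Qed.

(* Right-hand side of the recurrence at rank [n], for a sequence [A]. *)
Definition lassalle_rhs (A : nat -> int) (n : nat) : int :=
  (catalan n)%:Z
  + \sum_(1 <= j < n)
      (-1) ^+ j * ('C(n.*2.-1, j.*2.-1))%:Z * A j * (catalan (n - j))%:Z.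

(* [lassalle_seq n] is [:: 0; A_1; ...; A_n]; the entry of index 0 is a
   placeholder that the recurrence never reads. *)
Fixpoint lassalle_seq (n : nat) : seq int :=
  if n is m.+1 then
    let s := lassalle_seq m in
    rcons s ((-1) ^+ m * lassalle_rhs (fun j => s`_j) m.+1)
  else [:: 0].

Definition lassalle (n : nat) : int := (lassalle_seq n)`_n.

Lemma size_lassalle_seq (n : nat) : size (lassalle_seq n) = n.+1.
Proof. by elim: n => //= n IH; rewrite size_rcons IH. Qed.

Lemma nth_lassalle_seq (n j : nat) :
  (j <= n)%N -> (lassalle_seq n)`_j = lassalle j.
Proof.
elim: n => [|n IH]; first by case: j.
rewrite leq_eqVlt => /orP[/eqP->//|ltjn].
by rewrite /= nth_rcons size_lassalle_seq ltjn IH.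
Qed.

Lemma lassalleE (n : nat) : (1 <= n)%N ->
  (-1) ^+ (n - 1) * lassalle n = lassalle_rhs lassalle n.
Proof.
case: n => // n _; rewrite subn1 /lassalle /=.
rewrite nth_rcons size_lassalle_seq ltnn eqxx mulrA -exprD addnn -mul2n.
rewrite exprM sqrrN !expr1n mul1r; congr (_ + _).
by apply: eq_big_nat => j /andP[_ ltjn]; rewrite nth_lassalle_seq.
Qed.

Definition lassalle_a (n : nat) : rat :=
  2 * (lassalle n)%:~R / (catalan n)%:R.

(* Main.v *)
Require Import Defs.
From mathcomp Require Import all_boot all_order all_algebra.
From mathcomp Require Import ring lra zify.

(** The recurrence defining A_n is linear.  With c_n = 1 / (n! (n+1)!), the
    Taylor coefficients of B(t) = I_1(2 sqrt t) / sqrt t, one has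
    C_n = (2n)! c_n, and the recurrence says that the series h with
    coefficients h_n = (-1)^(n+1) A_n / (2n-1)! satisfies h B = 2 theta B, where
    theta = t d/dt: up to a factor, h is the logarithmic derivative of B
    ([logder_conv]).  The function B solves the second order equation
    theta^2 B + theta B = t B, so h solves the Riccati equation
    2 theta h + 2 h + h^2 = 4 t ([riccati]).  Its coefficients, rewritten in
    terms of a_n, are the quadratic recurrence ([lassalle_a_rec])

      2 n a_n = sum_(1 <= k < n) C(n, k-1) C(n, k+1) a_k a_(n-k),   a_1 = 2.

    All its terms are nonnegative, which gives positivity; the terms k = 1 and
    k = n of the recurrence for a_(n+1) give a_(n+1) >= n a_n
    ([lassalle_a_growth]), hence monotonicity.

    Integrality and parity are proved together, by strong induction, for the
    following statement ([parity_spec]): a_n is an integer; for odd n it is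
    even, and its half is odd exactly when n + 1 is a power of 2; for even n it
    is odd exactly when n + 2 is a power of 2.  Write w(n, k) for the product
    of binomials above.  Both k + 1 and k - 1 times w(n, k) are multiples of n,
    so n divides 2 w(n, k); refining this according to the parities of n and k,
    and using that a_k is even for odd k, one finds that 2 n divides every
    single term ([rec_term_dvd]).  So a_n is the sum of the quotients [quo],
    which are symmetric under k <-> n - k, and mod 2 (for n even) or mod 4 (for
    n odd) almost everything cancels:
    - for n = 2m only the middle quotient matters; it is even if m is even, and
      for m odd its parity is that of a_m / 2, because C(2m, m-1) is odd when
      m + 1 is a power of 2 ([quo_middle]);
    - for n odd, a_n / 2 is the sum of the quotients with k < n / 2.  When the
      odd member of the pair (k, n - k) exceeds 1 the quotient is even: an odd
      one would force both n - k and k to lie in fixed classes mod 4, for which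
      a binomial coefficient is even ([quo_odd]).  The pair (1, n - 1) has the
      parity of a_(n-1) ([quo_one]). *)

Set Implicit Arguments.
Unset Strict Implicit.
Unset Printing Implicit Defensive.

Import Order.TTheory GRing.Theory Num.Theory.
Local Open Scope ring_scope.

(** * Logarithmic derivative of a Bessel function *)

(** Taylor coefficients of I_1(2 sqrt t) / sqrt t. *)
Definition bessel (n : nat) : rat := (n`!%:R * n.+1`!%:R)^-1.

(** Coefficients of 2 theta B / B, B being the series with coefficients
    [bessel]: see [logder_conv]. *)
Definition logder (n : nat) : rat :=
  (-1) ^+ n.+1 * (lassalle n)%:~R / (n.*2.-1)`!%:R.

Lemma factR_neq0 (n : nat) : n`!%:R != 0 :> rat.
Proof. by rewrite pnatr_eq0 -lt0n fact_gt0. Qed.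

(* [field] writes n.+1%:R as 1 + n%:R in its side conditions. *)
Ltac natfield :=
  field; do ?[apply/andP; split];
  rewrite ?factR_neq0 // ?nat1r -?natrD ?pnatr_eq0 //.

Lemma binR_fact (n m : nat) : (m <= n)%N ->
  ('C(n, m))%:R = n`!%:R / (m`!%:R * (n - m)`!%:R) :> rat.
Proof.
move=> lemn; rewrite -(bin_fact lemn) !natrM mulfK //.
by rewrite mulf_neq0 ?factR_neq0.
Qed.

Lemma bessel_neq0 (n : nat) : bessel n != 0.
Proof. by rewrite invr_eq0 mulf_neq0 ?factR_neq0. Qed.

Lemma catalanR (n : nat) : (catalan n)%:R = (n.*2)`!%:R * bessel n :> rat.
Proof.
have n1 : n.+1%:R != 0 :> rat by rewrite pnatr_eq0.
apply: (mulfI n1); rewrite -natrM mul_catalan binR_fact; last by lia.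
have -> : (n.*2 - n = n)%N by lia.
rewrite /bessel factS natrM; have := factR_neq0 n.
by move=> ?; natfield.
Qed.

(** The equation t B'' + 2 B' = B, coefficient by coefficient. *)
Lemma bessel_ode (n : nat) : n.+1%:R * n.+2%:R * bessel n.+1 = bessel n.
Proof.
rewrite /bessel (factS n.+1) factS !natrM.
have := factR_neq0 n; have : n.+1%:R != 0 :> rat by rewrite pnatr_eq0.
have : n.+2%:R != 0 :> rat by rewrite pnatr_eq0.
by move=> *; natfield.
Qed.

(** The defining recurrence divided by (2n-1)!: the odd binomial turns it into
    the Cauchy product h B = 2 theta B. *)
Lemma logder_conv (n : nat) :
  \sum_(j < n.+1) logder j * bessel (n - j) = 2 * n%:R * bessel n.
Proof.
case: n => [|n]; first by rewrite big_ord_recr big_ord0 /= /logder; lra.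
have := congr1 (fun z : int => z%:~R : rat) (lassalleE (ltn0Sn n)).
rewrite -(big_mkord xpredT (fun j => logder j * bessel (n.+1 - j))) /=.
rewrite big_ltn // {1}/logder /= mulr0 !mul0r add0r.
rewrite /lassalle_rhs subn1 /= rmorphD rmorphM /= rmorphXn /= rmorphN1.
rewrite rmorph_sum /= => E; rewrite big_nat_recr //= subnn; move: E.
have fN : (n.*2.+1)`!%:R != 0 :> rat by exact: factR_neq0.
set S := \sum_(1 <= i < n.+1) _; set T := \sum_(1 <= i < n.+1) _.
have -> : S = - ((n.*2.+1)`!%:R * T).
  rewrite /S /T mulr_sumr -sumrN; apply: eq_big_nat => j /andP[j1 jn].
  rewrite !rmorphM /= rmorphXn /= rmorphN1 -!pmulrn catalanR.
  rewrite binR_fact; last by lia.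
  have -> : (n.*2.+1 - j.*2.-1 = (n.+1 - j).*2)%N by lia.
  rewrite /logder exprS; have := factR_neq0 (j.*2.-1).
  by have := factR_neq0 ((n.+1 - j).*2) => *; natfield.
rewrite -pmulrn catalanR {S}/logder doubleS /= factS natrM => E.
have -> : bessel 0 = 1 by [].
rewrite mulr1 !exprS !mulN1r opprK E.
have -> : (n.*2.+2)%:R = 2 * n.+1%:R :> rat by rewrite -natrM; congr _%:R; lia.
by field.
Qed.

Lemma dvdXnP (R : fieldType) (N : nat) (p : {poly R}) :
  reflect (forall i, (i < N)%N -> p`_i = 0) ('X^N %| p).
Proof.
apply: (iffP idP) => [/dvdpP[q ->] i iN|p0]; first by rewrite coefMXn iN.
rewrite -[p](poly_take_drop N); have -> : take_poly N p = 0.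
  by apply/polyP => i; rewrite coef_take_poly coef0; case: ifP => // /p0.
by rewrite add0r dvdp_mull.
Qed.

Lemma dvdXn_theta (R : fieldType) (N : nat) (p : {poly R}) :
  'X^N %| p -> 'X^N %| 'X * p^`().
Proof.
move=> /dvdXnP p0; apply/dvdXnP => -[|i] iN; first by rewrite coefXM.
by rewrite coefXM /= coef_deriv p0 ?mul0rn.
Qed.

(** Substituting h = 2 theta B / B in theta^2 B + theta B = t B gives
    2 theta h + 2 h + h^2 = 4 t; this is its coefficient of degree n.  Series are
    truncated to polynomials and compared modulo X^(n+1): B times the defect E
    of the Riccati equation is a combination of the defects D and W of the two
    linear equations, and B is invertible modulo X^(n+1). *)
Lemma riccati (n : nat) : (1 < n)%N ->
  \sum_(k < n.+1) logder k * logder (n - k) = - (2 * n.+1%:R * logder n).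
Proof.
move=> n_gt1; pose N := n.+1.
pose H := \poly_(i < N) logder i; pose B := \poly_(i < N) bessel i.
pose D := H * B - 2%:P * ('X * B^`()).
pose E := 2%:P * ('X * H^`()) + 2%:P * H + H * H - 4%:P * 'X.
pose W := 'X * ('X * B^`())^`() + 'X * B^`() - 'X * B.
have dD : 'X^N %| D.
  apply/dvdXnP => -[|i] iN; rewrite coefB coefCM coefXM coefM /=.
    by rewrite big_ord_recl big_ord0 !coef_poly /= /logder /=; lra.
  rewrite coef_deriv coef_poly iN -mulr_natr -[_ *+ _]mulr_natr.
  rewrite [X in _ - X](_ : _ = 2 * i.+1%:R * bessel i.+1); last by ring.
  rewrite -logder_conv; apply/eqP; rewrite subr_eq0; apply/eqP.
  apply: eq_bigr => j _; rewrite !coef_poly.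
  have -> : (j < N)%N by apply: leq_trans (ltn_ord j) _.
  by rewrite (leq_ltn_trans (leq_subr _ _)).
have dW : 'X^N %| W.
  apply/dvdXnP => -[|i] iN.
    by rewrite /W coefB coefD !coefXM /=; ring.
  rewrite /W coefB coefD !coefXM /= !coef_deriv coefXM /= coef_deriv.
  rewrite !coef_poly iN (ltnW iN).
  rewrite -(bessel_ode i) -[_ *+ i.+1]mulr_natr.
  rewrite -[i.+2]addn1 natrD; ring.
have EB : B * E = 2%:P * ('X * D^`()) + 2%:P * D + H * D + 4%:P * W.
  rewrite /E /D /W !(derivM, derivB, derivD, derivC, derivX).
  have -> : 4%:P = 2%:P * 2%:P :> {poly rat} by rewrite -polyCM.
  ring.
have dE : 'X^N %| E.
  have cB : coprimep 'X^N B.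
    rewrite coprimep_expl // coprimep_sym -['X]subr0 -polyC0 coprimep_XsubC.
    by rewrite rootE horner_coef0 coef_poly bessel_neq0.
  rewrite -(Gauss_dvdpr _ cB) EB.
  by rewrite !dvdp_add //; apply: dvdp_mull; rewrite ?dvdXn_theta.
have /dvdXnP/(_ n (ltnSn n)) := dE.
rewrite /E coefB !coefD !coefCM coefX coefXM coefM.
rewrite (gtn_eqF n_gt1).
case: n n_gt1 @N @H {B D E W dD dW EB dE} => // n n_gt1 N H.
rewrite /= coef_deriv coef_poly ltnSn.
under eq_bigr => i _.
  rewrite !coef_poly ltn_ord (leq_ltn_trans (leq_subr _ _)) //.
  over.
set S := \sum_(i < _) _; by rewrite -mulr_natr -[n.+2]addn1 natrD; lra.
Qed.

Lemma logderE (n : nat) : (0 < n)%N ->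
  logder n = (-1) ^+ n.+1 * lassalle_a n / (n.-1`!%:R * n.+1`!%:R).
Proof.
case: n => // n _; rewrite /lassalle_a catalanR /logder /bessel doubleS /=.
rewrite (factS n.*2.+1) (factS n.+1) (factS n) !natrM.
have -> : (n.*2.+2)%:R = 2 * n.+1%:R :> rat by rewrite -natrM; congr _%:R; lia.
have := factR_neq0 n.*2.+1; have := factR_neq0 n.
have : n.+1%:R != 0 :> rat by rewrite pnatr_eq0.
have : n.+2%:R != 0 :> rat by rewrite pnatr_eq0.
by move=> *; natfield.
Qed.

(** The Riccati equation in degree n, multiplied by (n!)^2. *)
Lemma lassalle_a_rec (n : nat) : (1 < n)%N ->
  (2 * n)%:R * lassalle_a n =
  \sum_(1 <= k < n) ('C(n, k.-1) * 'C(n, k.+1))%:R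
                    * (lassalle_a k * lassalle_a (n - k)).
Proof.
move=> n_gt1; have := riccati n_gt1.
rewrite -(big_mkord xpredT (fun j => logder j * logder (n - j))) /=.
have l0 : logder 0 = 0 by rewrite /logder /= mulr0 mul0r.
rewrite big_ltn // l0 mul0r add0r big_nat_recr ?(ltnW n_gt1) //=.
rewrite subnn l0 mulr0 addr0.
rewrite logderE ?(ltnW n_gt1) // => E.
have fn := factR_neq0 n.
have s m : ((-1) ^+ m) ^+ 2 = 1 :> rat.
  by rewrite -exprM mulnC exprM sqrrN !expr1n.
transitivity ((-1) ^+ n * n`!%:R ^+ 2
              * \sum_(1 <= k < n) logder k * logder (n - k)).
  rewrite E; case: n n_gt1 fn {E} => // n _ fn /=.
  rewrite (factS n.+1) (factS n) !natrM !exprS.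
  move: (s n); move: ((-1) ^+ n : rat) => e ee.
  have := factR_neq0 n.
  have : n.+1%:R != 0 :> rat by rewrite pnatr_eq0.
  have : n.+2%:R != 0 :> rat by rewrite pnatr_eq0.
  move=> n2 n1 f0.
  (* [field] does not know that e = (-1)^n squares to 1. *)
  transitivity (2 * n.+1%:R * lassalle_a n.+1 * e ^+ 2).
    by rewrite ee mulr1.
  by natfield.
rewrite mulr_sumr; apply: eq_big_nat => k /andP[k0 kn].
rewrite !logderE ?subn_gt0 // natrM !binR_fact; try lia.
have -> : (n - k.-1 = (n - k).+1)%N by lia.
have -> : (n - k.+1 = (n - k).-1)%N by lia.
have -> : (-1) ^+ n = (-1) ^+ k.+1 * (-1) ^+ (n - k).+1 :> rat.
  by rewrite -exprD -signr_odd -[RHS]signr_odd; congr (_ ^+ _); lia.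
move: (s k.+1) (s (n - k).+1).
move: ((-1) ^+ k.+1 : rat) ((-1) ^+ (n - k).+1 : rat) => e e' ee ee'.
have := factR_neq0 k.-1; have := factR_neq0 k.+1.
have := factR_neq0 (n - k).-1; have := factR_neq0 (n - k).+1 => *.
transitivity (n`!%:R / (k.-1`!%:R * (n - k).+1`!%:R) *
  (n`!%:R / (k.+1`!%:R * (n - k).-1`!%:R))
  * (lassalle_a k * lassalle_a (n - k)) * e ^+ 2 * e' ^+ 2).
  by natfield.
by rewrite ee ee' !mulr1.
Qed.

(** * Parity of binomial coefficients *)

Lemma dvdn_mul_bin (n k : nat) : (n %| k * 'C(n, k))%N.
Proof.
case: n k => [|n] [|k]; rewrite ?bin0n ?muln0 ?mul0n ?dvdn0 //.
by rewrite -mul_bin_diag dvdn_mulr.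
Qed.

Lemma even_bin (n k : nat) : ~~ odd n -> odd k -> ~~ odd 'C(n, k).
Proof.
move=> n2 ok; have := dvdn_trans _ (dvdn_mul_bin n k).
by move=> /(_ 2%N); rewrite !dvdn2 oddM ok; apply.
Qed.

Lemma even_bin_mod4 (n k : nat) :
  (n %% 4 = 1)%N -> (k %% 4 = 2)%N -> ~~ odd 'C(n, k).
Proof.
case: n k => // n [//|k] n4 k4; rewrite binS oddD negb_add.
have n0 : (4 %| n)%N by lia.
rewrite (negbTE (@even_bin n k _ _)); try lia.
have := dvdn_trans n0 (dvdn_mul_bin n k.+1).
have [l ->] : exists l, k.+1 = (2 * l.*2.+1)%N by exists (k.+1 %/ 4)%N; lia.
rewrite -mulnA (@dvdn_pmul2l 2 2) // dvdn2 oddM /=.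
by rewrite odd_double /= => /negbTE->.
Qed.

(** Adjacent entries of row 2^e - 1 add up to an inner entry of row 2^e, and
    these are even: 2^e divides (j+1) C(2^e, j+1) but not j+1. *)
Lemma odd_bin_pred_exp2 (e j : nat) : (j < 2 ^ e)%N -> odd 'C((2 ^ e).-1, j).
Proof.
elim: j => [|j IHj] lej; first by rewrite bin0.
have := IHj (ltnW lej); apply: contraLR => Cj1.
have e2 : (2 ^ e = (2 ^ e).-1.+1)%N by rewrite prednK ?expn_gt0.
have := dvdn_mul_bin (2 ^ e) j.+1; rewrite {2}e2 binS.
case: (boolP (odd 'C((2 ^ e).-1, j))) => // Cj.
rewrite Gauss_dvdl; last first.
  by rewrite coprimeXl // coprime2n oddD (negbTE Cj1) Cj.
by move=> /(dvdn_leq (ltn0Sn j)); rewrite leqNgt lej.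
Qed.

(** If m + 1 = 2^e, then 2m + 1 = 2^(e+1) - 1 indexes an all-odd row; dropping
    to row 2m preserves parity in even columns. *)
Lemma odd_bin_central (m : nat) :
  odd m -> 2%N.-nat m.+1 -> odd 'C(m.*2, m.-1).
Proof.
move=> om /p_natP[e me].
have := mul_bin_down (m.*2.+1) m.-1.
have -> : (m.*2.+1 = (2 ^ e.+1).-1)%N by rewrite expnS -me; lia.
move/(congr1 odd); rewrite !oddM odd_bin_pred_exp2; last by rewrite expnS; lia.
have -> : (2 ^ e.+1).-1.-1 = m.*2 by rewrite expnS -me; lia.
have -> : (2 ^ e.+1).-1 = m.*2.+1 by rewrite expnS -me; lia.
by rewrite /= odd_double /= => ->; lia.
Qed.

(** * Divisibility of the coefficients of the quadratic recurrence *)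

Definition weight (n k : nat) : nat := ('C(n, k.-1) * 'C(n, k.+1))%N.

Lemma weightC (n k : nat) : (0 < k < n)%N -> weight n (n - k) = weight n k.
Proof.
move=> /andP[k0 kn]; rewrite /weight mulnC -bin_sub; last by lia.
rewrite -[in X in (_ * X)%N]bin_sub; last by lia.
by congr ('C(_, _) * 'C(_, _))%N; lia.
Qed.

Lemma weight_middle (m : nat) : (0 < m)%N ->
  weight m.*2 m = ('C(m.*2, m.-1) * 'C(m.*2, m.-1))%N.
Proof.
move=> m0; rewrite /weight -(@bin_sub _ m.+1); last by lia.
by congr ('C(_, _) * 'C(_, _))%N; lia.
Qed.

Lemma dvdn_double (d w k : nat) : (0 < k)%N ->
  (d %| k.+1 * w)%N -> (d %| k.-1 * w)%N -> (d %| 2 * w)%N.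
Proof.
move=> k0 d1 d2; have -> : (2 * w = k.+1 * w - k.-1 * w)%N.
  by rewrite -mulnBl; congr muln; lia.
exact: dvdn_sub.
Qed.

(** n divides (k-1) C(n, k-1) and (k+1) C(n, k+1), so it divides the difference
    2 w of (k+1) w and (k-1) w. *)
Lemma dvdn_double_weight (n k : nat) : (0 < k)%N -> (n %| 2 * weight n k)%N.
Proof.
move=> k0; apply: (dvdn_double k0).
  by rewrite /weight mulnCA dvdn_mull // dvdn_mul_bin.
by rewrite /weight mulnA dvdn_mulr // dvdn_mul_bin.
Qed.

Lemma dvdn_weight_odd (n k : nat) : (0 < k)%N -> odd n -> (n %| weight n k)%N.
Proof.
move=> k0 on; have := dvdn_double_weight n k0.
by rewrite Gauss_dvdr // coprime_sym coprime2n.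
Qed.

(** Both binomials are even here, so the argument for [dvdn_double_weight] gains
    a factor 2 and yields w = n q; as k - 1 is odd, 2 n | (k-1) w then shows
    that q is even. *)
Lemma dvdn_weight_even (n k : nat) :
  (0 < k)%N -> ~~ odd n -> ~~ odd k -> (2 * n %| weight n k)%N.
Proof.
move=> k0 en ek.
have ev1 : (2 %| 'C(n, k.-1))%N by rewrite dvdn2 even_bin //; lia.
have ev2 : (2 %| 'C(n, k.+1))%N by rewrite dvdn2 even_bin //; lia.
have d1 : (2 * n %| k.-1 * weight n k)%N.
  by rewrite /weight mulnA mulnC dvdn_mul // dvdn_mul_bin.
have d2 : (2 * n %| k.+1 * weight n k)%N.
  by rewrite /weight mulnCA dvdn_mul // dvdn_mul_bin.
have d : (2 * n %| 2 * weight n k)%N by exact: dvdn_double d2 d1.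
have [->|n0] := posnP n; first by rewrite /weight bin0n /= !muln0.
rewrite dvdn_pmul2l // in d; case/dvdnP: d d1 => q ->.
rewrite mulnA dvdn_pmul2r // dvdn2 oddM => eq.
by rewrite dvdn_pmul2r // dvdn2; move: eq; lia.
Qed.

(** The weight is the square of c = C(2m, m-1), and 2m divides (m-1) c; so
    4 m^2, a multiple of 8m, divides (m-1)^2 w, where m - 1 is odd and w is
    already a multiple of 4m. *)
Lemma dvdn_weight_middle (m : nat) :
  (0 < m)%N -> ~~ odd m -> (4 * m.*2 %| weight m.*2 m)%N.
Proof.
move=> m0 em; pose c := 'C(m.*2, m.-1).
have Ew : weight m.*2 m = (c * c)%N by rewrite weight_middle.
have /dvdnP[x cx] : (m.*2 %| m.-1 * c)%N by apply: dvdn_mul_bin.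
have: (4 * m.*2 %| m.-1 ^ 2 * weight m.*2 m)%N.
  rewrite Ew -mulnn mulnACA.
  by rewrite cx -mulnA mulnCA mulnC dvdn_mul ?dvdn_mull //; lia.
have [q Ewq] := dvdnP (dvdn_weight_even m0 (negbT (odd_double m)) em).
rewrite Ewq mulnA [(2 * m.*2)%N]mulnC.
have -> : (4 * m.*2 = 2 * (m.*2 * 2))%N by lia.
rewrite !dvdn_pmul2r ?Gauss_dvdr //; try lia.
by rewrite coprimeXr // coprime2n; lia.
Qed.

(** * Sums of natural numbers modulo 2 *)

Lemma sum_nat_even (a b : nat) (F : nat -> nat) :
  (forall k, (a <= k < b)%N -> ~~ odd (F k)) ->
  ~~ odd (\sum_(a <= k < b) F k)%N.
Proof.
move=> Fe; rewrite -dvdn2 big_nat_cond; apply: dvdn_sum => k.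
by rewrite andbT dvdn2; exact: Fe.
Qed.

Lemma sum_nat_reflect (n h : nat) (F : nat -> nat) :
  (h < n)%N -> (forall k, (0 < k < n)%N -> F (n - k)%N = F k) ->
  (\sum_(n - h <= k < n) F k = \sum_(1 <= k < h.+1) F k)%N.
Proof.
move=> lthn Fs; have -> : (n - h = 1 + (n - h).-1)%N by lia.
rewrite big_addn big_nat_rev /=; have -> : (n - (n - h).-1 = h.+1)%N by lia.
apply: eq_big_nat => k /andP[k0 kh]; rewrite -[RHS]Fs; last by lia.
by congr F; lia.
Qed.

(** * Integrality and parity *)

(** For odd n the halves have to be tracked too: the parity of a_(2m) with m odd
    is that of a_m / 2. *)
Definition parity_spec (n a : nat) : bool :=
  if odd n then ~~ odd a && (odd a./2 == 2%N.-nat n.+1)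
  else odd a == 2%N.-nat n.+2.

Lemma pow2_mod4 (n : nat) : (2 < n)%N -> 2%N.-nat n -> (4 %| n)%N.
Proof.
move=> n2 /p_natP[[|[|e]] En]; rewrite ?En // in n2 *.
by rewrite !expnS mulnA dvdn_mulr.
Qed.

Lemma odd_pow2 (n : nat) : odd n -> 2%N.-nat n = (n == 1)%N.
Proof.
move=> on; apply/idP/eqP => [|-> //]; case/p_natP => [[|e]] // En.
by move: on; rewrite En expnS; lia.
Qed.

Lemma pow2_double (n : nat) : 2%N.-nat n.*2 = 2%N.-nat n.
Proof. by rewrite -mul2n pnatM. Qed.

Definition rec_term (u : nat -> nat) (n k : nat) : nat :=
  (weight n k * (u k * u (n - k)))%N.

(** The induction step, for any sequence of natural numbers in the place
    of a. *)
Section Step.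
Variables (u : nat -> nat) (n : nat).
Hypothesis n_gt1 : (1 < n)%N.
Hypothesis u1 : u 1%N = 2%N.
Hypothesis uP : forall k, (0 < k < n)%N -> parity_spec k (u k).

Let quo (k : nat) : nat := (rec_term u n k %/ (2 * n))%N.

Lemma spec_odd (k : nat) : (0 < k < n)%N -> odd k ->
  exists2 b, u k = (2 * b)%N & odd b = 2%N.-nat k.+1.
Proof.
move=> kn ok; have := uP kn; rewrite /parity_spec ok => /andP[eu /eqP ub].
by exists (u k)./2; [lia | ].
Qed.

Lemma spec_even (k : nat) : (0 < k < n)%N -> ~~ odd k ->
  odd (u k) = 2%N.-nat k.+2.
Proof.
by move=> kn ek; have := uP kn; rewrite /parity_spec (negbTE ek) => /eqP.
Qed.

Lemma rec_term_refl (k : nat) :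
  (0 < k < n)%N -> rec_term u n (n - k) = rec_term u n k.
Proof.
move=> kn; rewrite /rec_term weightC // subKn; last by lia.
by rewrite [(u k * _)%N]mulnC.
Qed.

Lemma rec_term_dvd_odd (k : nat) : odd n -> odd k -> (0 < k < n)%N ->
  (2 * n %| rec_term u n k)%N.
Proof.
move=> on ok kn; have [b ub _] := spec_odd kn ok.
rewrite /rec_term ub mulnC dvdn_mul // ?dvdn_weight_odd //; first last.
- by rewrite -mulnA dvdn_mulr.
- by case/andP: kn.
Qed.

(** For n odd, n divides the weight and one of the two factors u is even.  For
    n even and k odd, n divides twice the weight and both factors are even.
    For n and k even, 2 n divides the weight. *)
Lemma rec_term_dvd (k : nat) : (0 < k < n)%N -> (2 * n %| rec_term u n k)%N.
Proof.
move=> kn; have k0 : (0 < k)%N by case/andP: kn.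
have kn' : (0 < n - k < n)%N by lia.
have [on|en] := boolP (odd n); have [ok|ek] := boolP (odd k).
- exact: rec_term_dvd_odd.
- by rewrite -rec_term_refl // rec_term_dvd_odd //; lia.
- have [b ub _] := spec_odd kn ok.
  have [|b' ub' _] := spec_odd kn'; first by lia.
  rewrite /rec_term ub ub' mulnACA mulnA.
  rewrite (mulnC _ (2 * 2)%N) -mulnA -mulnA dvdn_mul //.
  by rewrite mulnA dvdn_mulr // dvdn_double_weight.
- by rewrite /rec_term dvdn_mulr // dvdn_weight_even.
Qed.

Lemma quoE (k q : nat) : rec_term u n k = (q * (2 * n))%N -> quo k = q.
Proof. by move=> E; rewrite /quo E mulnK //; lia. Qed.

(** An odd quotient needs u_k / 2 and u_(n-k) odd, so k + 1 and n - k + 2 are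
    powers of 2 greater than 2, hence multiples of 4.  Then n = 1 and k - 1 = 2
    mod 4, so C(n, k-1) is even. *)
Lemma quo_odd (k : nat) : odd n -> odd k -> (1 < k < n)%N -> ~~ odd (quo k).
Proof.
move=> on ok /andP[k1 kn].
have kn0 : (0 < k < n)%N by lia.
have kn' : (0 < n - k < n)%N by lia.
have [b ub ob] := spec_odd kn0 ok.
have ov : odd (u (n - k)) = 2%N.-nat (n - k).+2 by apply: spec_even => //; lia.
have /dvdnP[q Eq] : (n %| weight n k)%N by apply: dvdn_weight_odd => //; lia.
have -> : quo k = (q * b * u (n - k))%N.
  by apply: quoE; rewrite /rec_term Eq ub; ring.
rewrite !oddM ob ov; apply/negP.
move=> /andP[/andP[oq /pow2_mod4 k4] /pow2_mod4 nk4].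
have /negP[] : ~~ odd (weight n k).
  by rewrite oddM (negbTE (@even_bin_mod4 n k.-1 _ _)) //; lia.
by rewrite Eq oddM oq on.
Qed.

(** This quotient is (n-1)/2 times u_(n-1); when n + 1 is a power of 2 the
    first factor is odd. *)
Lemma quo_one : odd n -> odd (quo 1) = 2%N.-nat n.+1.
Proof.
move=> on; have ov : odd (u n.-1) = 2%N.-nat n.+1.
  by rewrite spec_even ?prednK //; lia.
have -> : quo 1 = (n.-1./2 * u n.-1)%N.
  apply: quoE; rewrite /rec_term /weight u1 bin0 bin2 subn1.
  have En : n = n.-1./2.*2.+1 by lia.
  by have -> : (n * n.-1)./2 = (n * n.-1./2)%N; [lia | ring].
rewrite oddM ov; case: (boolP (2%N.-nat _)); rewrite ?andbF // => /pow2_mod4.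
by lia.
Qed.

(** For m odd, write c = C(2m, m-1), c^2 = q m and u_m = 2 b: the quotient is
    q b^2, and c is odd whenever b is. *)
Lemma quo_middle (m : nat) : n = m.*2 -> odd (quo m) = 2%N.-nat n.+2.
Proof.
move=> En; have m0 : (0 < m)%N by lia.
have mn : (0 < m < n)%N by lia.
have nm : (n - m = m)%N by lia.
have -> : n.+2 = m.+1.*2 by lia.
rewrite pow2_double; have [om|em] := boolP (odd m).
  have [b ub ob] := spec_odd mn om.
  pose c := 'C(m.*2, m.-1).
  have Ew : weight n m = (c * c)%N by rewrite En weight_middle.
  have /dvdnP[q Eq] : (m %| c * c)%N.
    have := dvdn_double_weight n m0; rewrite Ew {1}En -mul2n dvdn_pmul2l //.
  have -> : quo m = (q * b * b)%N.
    by apply: quoE; rewrite /rec_term nm Ew Eq ub En -mul2n; ring.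
  have : odd (c * c) = odd (q * m) by rewrite Eq.
  rewrite !oddM ob om andbb andbT => <-; rewrite -andbA andbb andbC.
  by case: (boolP (2%N.-nat _)) => //= m2; rewrite /c odd_bin_central.
rewrite odd_pow2 //; have /dvdnP[q Eq] := dvdn_weight_middle m0 em.
have -> : quo m = (2 * q * (u m * u m))%N.
  by apply: quoE; rewrite /rec_term nm {1}En Eq En; ring.
by rewrite -mulnA oddM /=; lia.
Qed.

Lemma parity_spec_step : exists2 w, parity_spec n w &
  (\sum_(1 <= k < n) rec_term u n k = 2 * n * w)%N.
Proof.
exists (\sum_(1 <= k < n) quo k)%N; last first.
  rewrite big_distrr /=; apply: eq_big_nat => k kn.
  by rewrite /quo mulnC divnK // rec_term_dvd.
have qs k : (0 < k < n)%N -> quo (n - k)%N = quo k.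
  by move=> ?; rewrite /quo rec_term_refl.
rewrite /parity_spec; have [on|en] := boolP (odd n).
  pose r := n./2; have En : n = r.*2.+1 by lia.
  have -> : (\sum_(1 <= k < n) quo k = (\sum_(1 <= k < r.+1) quo k).*2)%N.
    rewrite -addnn -[in X in (_ + X)%N](@sum_nat_reflect n) //; last by lia.
    by rewrite (_ : n - r = r.+1)%N -?big_cat_nat //; lia.
  rewrite odd_double doubleK /= big_ltn; last by lia.
  rewrite oddD quo_one // (negbTE (sum_nat_even _)) ?addbF // => k kr.
  have [ok|ek] := boolP (odd k); first by apply: quo_odd => //; lia.
  by rewrite -qs; [apply: quo_odd => // | ]; lia.
pose m := n./2; have En : n = m.*2 by lia.
have -> : (\sum_(1 <= k < n) quo k =
           quo m + (\sum_(1 <= k < m) quo k).*2)%N.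
  rewrite -addnn addnCA -{3}(@prednK m) -?(@sum_nat_reflect n) //; try lia.
  by rewrite (_ : n - m.-1 = m.+1)%N -?big_ltn -?big_cat_nat //; lia.
by rewrite oddD odd_double addbF (quo_middle En).
Qed.

End Step.

Lemma lassalle_a1 : lassalle_a 1 = 2.
Proof. by rewrite /lassalle_a /lassalle /= /lassalle_rhs big_geq. Qed.

Lemma lassalle_a_parity (n : nat) : (0 < n)%N ->
  exists2 a : nat, parity_spec n a & lassalle_a n = a%:R.
Proof.
pose u k := `|numq (lassalle_a k)|%N.
have uE k (a : nat) : lassalle_a k = a%:R -> u k = a.
  by rewrite /u => ->; rewrite pmulrn numq_int.
have u1 : u 1%N = 2%N by apply: uE; exact: lassalle_a1.
elim/ltn_ind: n => -[|[|n]] // IH _.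
  by exists 2%N => //; exact: lassalle_a1.
have uP k : (0 < k < n.+2)%N ->
    parity_spec k (u k) /\ lassalle_a k = (u k)%:R.
  by move=> /andP[k0 kn]; have [a Pa Ea] := IH k kn k0; rewrite (uE _ _ Ea).
have [k /uP[] //|w Pw Ew] := @parity_spec_step u n.+2 isT u1.
exists w => //; have n0 : (2 * n.+2)%:R != 0 :> rat by rewrite pnatr_eq0.
apply: (mulfI n0); rewrite lassalle_a_rec // -natrM -Ew natr_sum.
apply: eq_big_nat => k kn; have [_ ->] := uP k kn.
by have [|_ ->] := uP (n.+2 - k)%N; [lia | rewrite /rec_term /weight !natrM].
Qed.

(** * Positivity and growth *)

Lemma lassalle_a_gt0 (n : nat) : (0 < n)%N -> 0 < lassalle_a n.
Proof.
elim/ltn_ind: n => -[|[|n]] // IH _; first by rewrite lassalle_a1.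
have n0 : 0 < (2 * n.+2)%:R :> rat by rewrite ltr0n.
rewrite -(pmulr_rgt0 _ n0) lassalle_a_rec // big_nat_recr //=.
apply: ltr_wpDl.
  rewrite big_nat_cond; apply: sumr_ge0 => k; rewrite andbT => kn.
  apply: mulr_ge0; first exact: ler0n.
  by apply: mulr_ge0; apply/ltW/IH; lia.
apply: mulr_gt0; first by rewrite ltr0n muln_gt0 !bin_gt0; lia.
by apply: mulr_gt0; apply: IH; lia.
Qed.

(** Keep only the terms k = 1 and k = n of the recurrence for a_(n+1): each
    equals C(n+1, 2) * 2 a_n.  They are distinct as n > 1. *)
Lemma lassalle_a_growth (n : nat) : (1 < n)%N ->
  n%:R * lassalle_a n <= lassalle_a n.+1.
Proof.
move=> n1; have N0 : 0 < (2 * n.+1)%:R :> rat by rewrite ltr0n.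
rewrite -(ler_pM2l N0) lassalle_a_rec; last by lia.
rewrite big_nat_recr /=; last by lia.
rewrite big_ltn // subn1 subSnn lassalle_a1 /= bin0 mul1n binn muln1.
have -> : 'C(n.+1, n.-1) = 'C(n.+1, 2).
  by rewrite -bin_sub; [congr 'C(_, _) | ]; lia.
have -> : (2 * n.+1)%:R * (n%:R * lassalle_a n) =
    ('C(n.+1, 2))%:R * (2 * lassalle_a n)
    + ('C(n.+1, 2))%:R * (lassalle_a n * 2) :> rat.
  rewrite -[lassalle_a n * 2]mulrC -mulrDl -natrD addnn.
  have -> : 'C(n.+1, 2).*2 = (n.+1 * n)%N by rewrite -mul2n -mul_bin_diag bin1.
  by rewrite !natrM; ring.
rewrite lerD2r lerDl big_nat_cond; apply: sumr_ge0 => k; rewrite andbT => kn.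
apply: mulr_ge0; first exact: ler0n.
by apply: mulr_ge0; apply/ltW/lassalle_a_gt0; lia.
Qed.

Theorem theorem2 :
  (forall n : nat, (2 <= n)%N ->
     (exists m : nat, (0 < m)%N /\ lassalle_a n = m%:R)
     /\ lassalle_a n < lassalle_a n.+1)
  /\
  (forall n : nat, (2 <= n)%N ->
     ((exists m : int, lassalle_a n = (2 * m + 1)%:~R)
      <-> (exists k : nat, (2 <= k)%N /\ n = (2 ^ k - 2)%N))).
Proof.
split=> n n2; have n0 : (0 < n)%N by lia.
  have an0 := lassalle_a_gt0 n0; split.
    have [a _ Ea] := lassalle_a_parity n0; exists a; split=> //.
    by rewrite -(ltr0n rat) -Ea.
  apply: lt_le_trans (lassalle_a_growth n2).
  by rewrite ltr_pMl // ltr1n.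
have [a Pa Ea] := lassalle_a_parity n0.
have -> : (exists m : int, lassalle_a n = (2 * m + 1)%:~R) <-> odd a.
  rewrite Ea; split=> [[m]|oa].
    by rewrite [in LHS]pmulrn => /intr_inj; lia.
  by exists (a./2)%:Z; rewrite [LHS]pmulrn; congr _%:~R; lia.
move: Pa; rewrite /parity_spec.
have [on /andP[/negbTE-> _]|en /eqP->] := boolP (odd n).
  by split=> // -[[|k] [] //]; rewrite expnS => _ En; move: on; lia.
split=> [/p_natP[[|[|k]] En]|[k [k2 ->]]];
  try by move: En; rewrite ?expn0 ?expn1; lia.
  by exists k.+2; split=> //; lia.
have k4 : (2 < 2 ^ k)%N by rewrite (@ltn_exp2l 2 1).
by have -> : (2 ^ k - 2).+2 = (2 ^ k)%N; [lia | rewrite pnatX].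
Qed.
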